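(* For each integer $g\geq 2$ there exists a large set of H-designs LH$(10,g,4,3)$.
   Context: An H-design H$(n,g,k,t)$ is a triple $(Q,G,B)$ where $Q$ is a set of $ng$ points, $G$ is a partition of $Q$ into $n$ groups of size $g$, and $B$ is a set of $k$-subsets of $Q$ (blocks) such that each block meets each group in at most one point and any $t$ points from $t$ distinct groups lie in exactly one block. A large set of H-designs LH$(n,g,k,t)$ is a partition of the set of all $k$-subsets of $Q$ meeting each group of $G$ in at most one point into pairwise disjoint block sets, each of which forms (with $Q$ and $G$) an H-design H$(n,g,k,t)$. *)

(* Defs.v *)
From mathcomp Require Import all_boot.
Set Implicit Arguments. Unset Strict Implicit. Unset Printing Implicit Defensive.

Section HDesigns.
Variable T : finType.

Definition group_division (n g : nat) (G : {set {set T}}) : bool :=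
  [&& partition G [set: T], #|G| == n & [forall P in G, #|P| == g]].

Definition transverse (G : {set {set T}}) (A : {set T}) : bool :=
  [forall P in G, #|A :&: P| <= 1].

Definition H_design (n g k t : nat) (G : {set {set T}}) (B : {set {set T}}) : bool :=
  [&& group_division n g G,
      [forall b in B, (#|b| == k) && transverse G b] &
      [forall S : {set T}, ((#|S| == t) && transverse G S) ==>
                            (#|[set b in B | S \subset b]| == 1)]].

Definition transverse_ksets (k : nat) (G : {set {set T}}) : {set {set T}} :=
  [set A : {set T} | (#|A| == k) && transverse G A].

Definition large_set_H (n g k t : nat) (G : {set {set T}})
    (F : {set {set {set T}}}) : bool :=
  [&& group_division n g G,
      partition F (transverse_ksets k G) &
      [forall B in F, H_design n g k t G B]].
End HDesigns.

Definition exists_LH (n g k t : nat) : Prop :=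
  exists (T : finType) (G : {set {set T}}) (F : {set {set {set T}}}),
    large_set_H n g k t G F.

(* Main.v *)
Require Import Defs.
From mathcomp Require Import all_boot.
From mathcomp Require Import ssralg zmodp.
Set Implicit Arguments. Unset Strict Implicit. Unset Printing Implicit Defensive.

(** Call a list of Steiner systems S(t, t+1, n) on the same points g-fold if it
    covers every (t+1)-subset exactly g times; repetitions are allowed, so that
    g-fold and h-fold lists concatenate to a (g+h)-fold one.  A g-fold list
    [D] gives an LH(n, g, t+1, t) on the points [X * Z_g]: a transverse
    (t+1)-set A projects onto a subset b of X contained in exactly g members of
    [D], and A is put in the class of the s-th of these, s being the sum in Z_g
    of the second coordinates of A.  For (n, t) = (10, 3) there is no 1-fold
    list, but there is a 2-fold one (14 copies of SQS(10)) and a 3-fold one (21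
    copies), hence a g-fold one for every g >= 2. *)

(** * Multifold lists of Steiner systems *)

Section SteinerSystems.
Variable X : finType.
Implicit Types (b S : {set X}) (B : {set {set X}}) (D : seq {set {set X}}).

Definition steiner (t : nat) B : bool :=
  [forall b in B, #|b| == t.+1] &&
  [forall S : {set X}, (#|S| == t) ==> (#|[set b in B | S \subset b]| == 1)].

Definition multifold_large_set (t g : nat) D : bool :=
  all (steiner t) D &&
  [forall b : {set X}, (#|b| == t.+1) ==> (count (fun B => b \in B) D == g)].

Lemma multifold_large_set_cat t g h D E :
    multifold_large_set t g D -> multifold_large_set t h E ->
  multifold_large_set t (g + h) (D ++ E).
Proof.
move=> /andP[sD /forallP cD] /andP[sE /forallP cE]; rewrite /multifold_large_set.
rewrite all_cat sD sE /=; apply/forallP => b; apply/implyP => bt.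
by rewrite count_cat (eqP (implyP (cD b) bt)) (eqP (implyP (cE b) bt)).
Qed.

(** Positions in [D] are recorded rather than members: they are distinct even when a system is
    repeated in [D]. *)
Definition covering D b : seq nat :=
  [seq c <- iota 0 (size D) | b \in nth set0 D c].

Lemma size_covering D b : size (covering D b) = count (fun B => b \in B) D.
Proof.
rewrite size_filter -[in RHS](mkseq_nth set0 D) /mkseq count_map.
exact: eq_count.
Qed.

Lemma mem_covering D b c :
  (c \in covering D b) = (c < size D) && (b \in nth set0 D c).
Proof. by rewrite mem_filter mem_iota /= add0n andbC. Qed.

End SteinerSystems.

(** * The groups, as fibers of a product *)

Section Fibers.
Variables (X Y : finType).
Implicit Type A : {set X * Y}.

Definition fibers : {set {set X * Y}} :=
  [set [set p : X * Y | p.1 == x] | x : X].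

Lemma mem_fibers (x : X) : [set p : X * Y | p.1 == x] \in fibers.
Proof. exact: imset_f. Qed.

Lemma card_fiber (x : X) : #|[set p : X * Y | p.1 == x]| = #|Y|.
Proof.
rewrite (_ : [set p | _] = setX [set x] setT) ?cardsX ?cards1 ?cardsT ?mul1n //.
by apply/setP => p; rewrite !inE andbT.
Qed.

Lemma group_division_fibers : 0 < #|Y| -> group_division #|X| #|Y| fibers.
Proof.
(* The element [y] shows that fibers are nonempty and that distinct points have distinct fibers. *)
move=> Y_gt0; have [y _] := card_gt0P Y_gt0.
apply/and3P; split; last first.
- by apply/forall_inP => _ /imsetP[x _ ->]; rewrite card_fiber.
- rewrite card_imset // => x1 x2 /setP/(_ (x1, y)).
  by rewrite !inE /= eqxx => /esym/eqP.
apply/and3P; split.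
- apply/eqP/setP => p; rewrite [RHS]inE; apply/bigcupP.
  by exists [set q : X * Y | q.1 == p.1]; rewrite ?inE ?mem_fibers.
- apply/trivIsetP => _ _ /imsetP[x1 _ ->] /imsetP[x2 _ ->] neq.
  rewrite -setI_eq0; apply/eqP/setP => p; rewrite !inE.
  by apply/andP => -[/eqP e1 /eqP e2]; rewrite -e1 -e2 eqxx in neq.
by apply/imsetP => -[x _] /setP/(_ (x, y)); rewrite !inE eqxx.
Qed.

Lemma transverse_fibersP A :
  reflect {in A &, injective fst} (transverse fibers A).
Proof.
apply: (iffP forall_inP) => [trA p q pA qA epq | injA _ /imsetP[x _ ->]].
  have /card_le1_eqP := trA _ (mem_fibers p.1).
  by apply; rewrite !inE ?pA ?qA /= -?epq eqxx.
apply/card_le1_eqP => p q /setIP[pA] + /setIP[qA].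
by rewrite !inE => /eqP ep /eqP eq; apply: injA; rewrite // ep eq.
Qed.

Lemma card_transverse_fst A : transverse fibers A -> #|fst @: A| = #|A|.
Proof. by move/transverse_fibersP/card_in_imset. Qed.

End Fibers.

(** * From a multifold list to a large set *)

Section Lifting.
Variables (X : finType) (g t : nat) (D : seq {set {set X}}).
Hypothesis D_large : multifold_large_set t g.+1 D.
Local Notation T := (X * 'I_g.+1)%type.
Local Notation G := (fibers X 'I_g.+1).
Implicit Types A S : {set T}.

Definition level A : 'I_g.+1 := (\sum_(p in A) p.2)%R.

(** The default 0 is never reached on a transverse (t+1)-set: its covering has exactly [g.+1]
    entries. *)
Definition color A : nat := nth 0 (covering D (fst @: A)) (level A).

Lemma size_covering_fst A :
  A \in transverse_ksets t.+1 G -> size (covering D (fst @: A)) = g.+1.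
Proof.
rewrite inE => /andP[/eqP cA trA]; rewrite size_covering.
case/andP: D_large => _ /forallP/(_ (fst @: A)).
by rewrite card_transverse_fst // cA eqxx => /eqP.
Qed.

Lemma color_covering A :
  A \in transverse_ksets t.+1 G -> color A \in covering D (fst @: A).
Proof. by move=> tA; rewrite mem_nth // size_covering_fst. Qed.

Lemma color_eq A c :
    A \in transverse_ksets t.+1 G -> c \in covering D (fst @: A) ->
  (color A == c) = (level A == index c (covering D (fst @: A)) :> nat).
Proof.
move=> tA cA; rewrite -{1}(nth_index 0 cA) nth_uniq ?index_mem //.
  by rewrite size_covering_fst.
by rewrite filter_uniq ?iota_uniq.
Qed.

(** The system at position [c] has a unique block [b] containing the projection of [S], and [b] has
    one further point [x]. A set of color [c] containing [S] must be [S] with some [(x, z)] added,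
    and the color determines [z] through the level. *)
Lemma color_class_extension c S :
    c < size D -> #|S| = t -> transverse G S ->
  #|[set A in [set A in transverse_ksets t.+1 G | c == color A]
     | S \subset A]| == 1.
Proof.
move=> cD cS trS; have cpS : #|fst @: S| = t by rewrite card_transverse_fst.
case/andP: (D_large) => /(all_nthP set0)/(_ c cD)/andP[/forall_inP Dcard].
move=> /forallP/(_ (fst @: S)); rewrite cpS eqxx /= => /cards1P[b Db] _.
have := set11 b; rewrite -Db inE => /andP[bD Sb].
have : #|b :\: fst @: S| == 1.
  by rewrite cardsD (setIidPr Sb) cpS (eqP (Dcard _ bD)) subSnn.
case/cards1P => x Ex; have xS : x \notin fst @: S.
  by have := set11 x; rewrite -Ex inE => /andP[].
have Eb : b = x |: fst @: S by rewrite -(setID b (fst @: S)) (setIidPr Sb) Ex setUC.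
have cb : c \in covering D b by rewrite mem_covering cD.
set r := index c (covering D b).
have szb : size (covering D b) = g.+1.
  rewrite size_covering; case/andP: (D_large) => _ /forallP/(_ b).
  by rewrite (eqP (Dcard _ bD)) eqxx => /eqP.
have r_lt : r < g.+1 by rewrite -szb index_mem.
(* The value that brings the level to [r], the rank of [c] in the covering of [b]. *)
pose y : 'I_g.+1 := (Ordinal r_lt - level S)%R.
have notS z : (x, z) \notin S by apply: contra xS => /(imset_f fst).
have levelU z : level ((x, z) |: S) = (z + level S)%R.
  by rewrite /level big_setU1.
have fstU z : fst @: ((x, z) |: S) = b by rewrite imsetU1 Eb.
have tU z : (x, z) |: S \in transverse_ksets t.+1 G.
  (* Transversality follows by counting: the set and its projection [b] both have [t.+1]
     elements. *)
  rewrite inE cardsU1 notS cS eqxx /=; apply/transverse_fibersP/imset_injP.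
  by rewrite fstU cardsU1 notS cS (eqP (Dcard _ bD)).
have colorU z : (c == color ((x, z) |: S)) = (z == y).
  rewrite eq_sym color_eq ?fstU // levelU -/r.
  by rewrite -[r]/(nat_of_ord (Ordinal r_lt)) val_eqE [RHS]eq_sym GRing.subr_eq eq_sym.
apply/cards1P; exists ((x, y) |: S); apply/setP => A; rewrite [LHS]inE [in RHS]inE.
apply/andP/eqP => [[] | ->]; last by rewrite inE tU colorU eqxx subsetUr.
rewrite inE => /andP[tA /eqP cA] SA.
have /[!inE]/andP[/eqP cardA trA] := tA.
have fstA : fst @: A = b.
  apply/set1P; rewrite -Db inE imsetS // andbT.
  by have := color_covering tA; rewrite -cA mem_covering => /andP[].
have /imsetP[[x' z] pA /= ex] : x \in fst @: A by rewrite fstA Eb setU11.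
move: pA; rewrite -ex => pA; have EA : A = (x, z) |: S.
  apply/eqP; rewrite eq_sym eqEcard subUset sub1set pA SA cardA.
  by rewrite cardsU1 notS cS leqnn.
by move/eqP: cA; rewrite EA colorU => /eqP ->.
Qed.

Lemma large_set_H_colors :
  large_set_H #|X| g.+1 t.+1 t G
    (preim_partition color (transverse_ksets t.+1 G)).
Proof.
have gdG : group_division #|X| g.+1 G.
  by have := @group_division_fibers X 'I_g.+1; rewrite card_ord; apply.
rewrite /large_set_H gdG preim_partitionP; apply/forall_inP => _ /imsetP[A0 tA0 ->].
rewrite /H_design gdG /=; apply/andP; split.
  by apply/forall_inP => A; rewrite !inE => /andP[].
apply/forallP => S; apply/implyP => /andP[/eqP cS trS].
(* It remains to see that the color of the representative [A0] is a position in [D]. *)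
apply: color_class_extension => //.
by have := color_covering tA0; rewrite mem_covering => /andP[].
Qed.

End Lifting.

Lemma exists_LH_multifold (X : finType) (g t : nat) (D : seq {set {set X}}) :
  0 < g -> multifold_large_set t g D -> exists_LH #|X| g t.+1 t.
Proof.
case: g => // g _ D_large; exists (X * 'I_g.+1)%type, (fibers X 'I_g.+1).
by eexists; apply: large_set_H_colors D_large.
Qed.

(** * Deciding the covering conditions on lists of numbers *)

Section ListedSets.
Variable n : nat.
Implicit Types (b : {set 'I_n}) (l : seq nat) (L : seq (seq nat)).

Definition set_of_list l : {set 'I_n} := [set i : 'I_n | val i \in l].
Definition list_of_set b : seq nat := [seq val i | i <- enum b].
(** A canonical form: equality of sets becomes equality of increasing lists, decidable by
    evaluation. *)
Definition normal_list l : seq nat := [seq i <- iota 0 n | i \in l].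

Lemma mem_list_of_set b (i : 'I_n) : (val i \in list_of_set b) = (i \in b).
Proof. by rewrite mem_map ?mem_enum //; apply: val_inj. Qed.

Lemma list_of_setK : cancel list_of_set set_of_list.
Proof. by move=> b; apply/setP => i; rewrite inE mem_list_of_set. Qed.

Lemma set_of_listK l : list_of_set (set_of_list l) = normal_list l.
Proof.
rewrite /list_of_set /normal_list -val_enum_ord filter_map; congr map.
rewrite {1}/enum_mem -enumT; apply: eq_filter => i; exact: in_set.
Qed.

Fixpoint sublists (s : seq nat) : seq (seq nat) :=
  if s is x :: s' then sublists s' ++ map (cons x) (sublists s') else [:: [::]].

Lemma mem_sublists s l : subseq l s -> l \in sublists s.
Proof.
elim: s l => [|x s IHs] [|y l] //=; first by rewrite mem_cat IHs ?sub0seq.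
case: eqP => [-> /IHs ? | _ /IHs ?]; rewrite mem_cat; last by apply/orP; left.
by rewrite map_f ?orbT.
Qed.

Definition ksublists k := [seq l <- sublists (iota 0 n) | size l == k].

Lemma list_of_set_ksublists b k : #|b| = k -> list_of_set b \in ksublists k.
Proof.
move=> <-; rewrite mem_filter size_map -cardE eqxx mem_sublists //.
rewrite -[b]list_of_setK set_of_listK; exact: filter_subseq.
Qed.

Definition blocks_of L : {set {set 'I_n}} := [set:: map set_of_list L].

Lemma mem_blocks_of L b :
  (b \in blocks_of L) = (list_of_set b \in map normal_list L).
Proof.
rewrite inE -(mem_map (can_inj list_of_setK)) -map_comp.
by congr (_ \in _); apply: eq_map => l /=; rewrite set_of_listK.
Qed.

(** The [uniq] test makes counting lists agree with counting blocks. *)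
Definition steiner_lists t L : bool :=
  let L' := map normal_list L in
  [&& uniq L', all (fun l => size l == t.+1) L' &
      all (fun l => count (fun m => all (mem m) l) L' == 1) (ksublists t)].

Lemma steiner_listsP t L : steiner_lists t L -> steiner t (blocks_of L).
Proof.
case/and3P=> uL /allP szL /allP cL; apply/andP; split.
  apply/forall_inP => b; rewrite mem_blocks_of => /szL.
  by rewrite size_map -cardE.
apply/forallP => S; apply/implyP => /eqP/list_of_set_ksublists/cL.
have -> : [set b in blocks_of L | S \subset b]
        = [set:: [seq b : {set _} <- map set_of_list L | S \subset b]].
  by apply/setP => b; rewrite !inE mem_filter andbC.
have uS : uniq (map set_of_list L).
  rewrite -(map_inj_uniq (can_inj list_of_setK)) -map_comp.
  by rewrite (eq_map set_of_listK).
rewrite cardsE (card_uniqP _) ?filter_uniq // size_filter count_map.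
rewrite count_map => /eqP <-; apply/eqP/eq_count => l /=; rewrite -set_of_listK.
apply/subsetP/allP => [sub _ /mapP[i iS ->] | sub i iS].
  by rewrite inE mem_list_of_set sub // -mem_enum.
by have := sub (val i); rewrite inE !mem_list_of_set; apply.
Qed.

Definition multifold_lists t g (LL : seq (seq (seq nat))) : bool :=
  all (steiner_lists t) LL &&
  let LL' := map (map normal_list) LL in
  all (fun l => count (fun L => l \in L) LL' == g) (ksublists t.+1).

Lemma multifold_listsP t g LL :
  multifold_lists t g LL -> multifold_large_set t g (map blocks_of LL).
Proof.
case/andP=> /allP sLL /allP cLL; apply/andP; split.
  by apply/allP => _ /mapP[L LLL ->]; apply/steiner_listsP/sLL.
apply/forallP => b; apply/implyP => /eqP/list_of_set_ksublists/cLL.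
rewrite !count_map => /eqP <-; apply/eqP/eq_count => L /=.
exact: mem_blocks_of.
Qed.

End ListedSets.

(** * Ten points *)

(* The Steiner quadruple systems of order 10 are all isomorphic to this cyclic one. *)
Definition sqs10 : seq (seq nat) :=
  [seq [seq (x + i) %% 10 | x <- q]
     | q <- [:: [:: 0; 1; 3; 4]; [:: 0; 1; 2; 6]; [:: 0; 2; 4; 7]], i <- iota 0 10].

Definition relabel (w : seq nat) : seq (seq nat) -> seq (seq nat) :=
  map (map (nth 0 w)).

(* The lists are unions of orbits of isomorphic copies of [sqs10] under a
   permutation of the points, of type (6, 3, 1) here and (7, 1, 1, 1) in
   [threefold10]; they were found by computer search. *)
Definition twofold10 : seq (seq (seq nat)) :=
  let B := relabel [:: 0; 1; 2; 4; 3; 7; 6; 5; 8; 9] sqs10 in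
  let orbit w := traject (relabel [:: 1; 2; 3; 4; 5; 0; 7; 8; 6; 9]) (relabel w sqs10) 6 in
  [:: B; B] ++ orbit [:: 0; 1; 2; 8; 7; 5; 3; 4; 6; 9]
            ++ orbit [:: 0; 1; 2; 8; 4; 6; 3; 5; 7; 9].

Definition threefold10 : seq (seq (seq nat)) :=
  let orbit w := traject (relabel [:: 1; 2; 3; 4; 5; 6; 0; 7; 8; 9]) (relabel w sqs10) 7 in
  orbit [:: 0; 1; 2; 4; 5; 6; 3; 8; 9; 7] ++
  orbit [:: 0; 1; 2; 5; 9; 4; 3; 8; 7; 6] ++
  orbit [:: 0; 1; 2; 3; 5; 8; 4; 9; 7; 6].

(** A finite check, over the 120 triples for each system and over the 210 quadruples for the whole
    list. *)
Lemma twofold10P : multifold_lists 10 3 2 twofold10.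
Proof. by vm_compute. Qed.

Lemma threefold10P : multifold_lists 10 3 3 threefold10.
Proof. by vm_compute. Qed.

(** Every such [g] is reached from 2 or 3 by repeatedly adding 2. *)
Lemma multifold_large_set10 (g : nat) :
  2 <= g -> exists D : seq {set {set 'I_10}}, multifold_large_set 3 g D.
Proof.
elim/ltn_ind: g => -[|[|[|[|g]]]] IHg // _.
- by eexists; apply: multifold_listsP twofold10P.
- by eexists; apply: multifold_listsP threefold10P.
have [//|//|D D_large] := IHg g.+2.
eexists; rewrite -[g.+4]add2n.
exact: multifold_large_set_cat (multifold_listsP twofold10P) D_large.
Qed.

Theorem theorem17 (g : nat) (hg : 2 <= g) : exists_LH 10 g 4 3.
Proof.
have [D D_large] := multifold_large_set10 hg.
by rewrite -[10]card_ord; apply: exists_LH_multifold D_large; apply: ltnW.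
Qed.
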